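(* Let $A\in\mathbb{R}^{n\times n}$, $B\in\mathbb{R}^{n\times m}$, let $F\in\mathbb{R}^{r\times n}$ have full row rank $r$, and let $F^-$ be a generalized inverse of $F$. Let $\Lambda=\{\lambda_1,\dots,\lambda_r\}$ be the set of specified $r$ eigenvalues anywhere on the left half of the complex plane. If the conditions $$\operatorname{rank}\begin{pmatrix} FA \\ F \end{pmatrix}=\operatorname{rank}(F)\quad\text{and}\quad \operatorname{rank}\begin{pmatrix}sF-FA & FB\end{pmatrix}=\operatorname{rank}(F)\ \text{ for all } s\in\mathbb{C}$$ are satisfied, then the control law $u(t)=-ZFx(t)$, $Z\in\mathbb{R}^{m\times r}$, for the system $\dot{x}(t)=Ax(t)+Bu(t)$ can place $r$ eigenvalues of $FAF^--FBZ$ at $\Lambda$, and these eigenvalues are a subset of the eigenvalues of $A-BZF$.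
   Context: The system is $\dot{x}(t)=Ax(t)+Bu(t)$ with state $x(t)\in\mathbb{R}^n$ and input $u(t)\in\mathbb{R}^m$. A generalized inverse $X^-$ of a matrix $X$ is a matrix satisfying $XX^-X=X$.
   Formalization: The specified eigenvalues Λ are additionally assumed closed under complex conjugation (with multiplicity); without this no real Z can exist, e.g. n = m = r = 1, A = 0, B = F = 1, Λ = {-1+i}. *)

(* Defs.v *)
From mathcomp Require Import all_boot all_order all_algebra.
From mathcomp Require Import reals.
From mathcomp Require Import complex.

Set Implicit Arguments.
Unset Strict Implicit.
Unset Printing Implicit Defensive.

Import GRing.Theory.
Local Open Scope ring_scope.
Local Open Scope complex_scope.

Definition generalized_inverse (K : fieldType) (p q : nat)
  (X : 'M[K]_(p, q)) (Y : 'M[K]_(q, p)) : Prop := X *m Y *m X = X.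

Definition complexify (R : realType) (p q : nat) (M : 'M[R]_(p, q)) :
  'M[R[i]]_(p, q) := map_mx (real_complex R) M.

(* [s] lists all complex eigenvalues of the real matrix [M], each repeated
   according to its algebraic multiplicity (so that [size s = p]). *)
Definition eigenvalue_list (R : realType) (p : nat) (M : 'M[R]_p)
  (s : seq R[i]) : Prop :=
  char_poly (complexify M) = \prod_(z <- s) ('X - z%:P).

(* Invariance under conjugation as a multiset. The eigenvalues of a real matrix
   always satisfy it, so a spectrum prescribed for a real matrix has to. *)
Definition self_conjugate (R : realType) (s : seq R[i]) : Prop :=
  perm_eq [seq z^* | z <- s] s.

(* Main.v *)
(* With [N = F A F^-], the rank conditions give [F A = N F] and the Hautus
   condition for the pair [(N, F B)]. Pole placement for this pair yields [Z],
   and [F (A - B Z F) = (N - F B Z) F] makes the characteristic polynomial of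
   [N - F B Z] divide that of [A - B Z F].
   Pole placement is proved in dual form (output injection): Heymann's lemma
   reduces to a single output, which Ackermann's formula handles. *)

Require Import Defs.
From mathcomp Require Import all_boot all_order all_algebra.
From mathcomp Require Import reals.
From mathcomp Require Import complex.

Set Implicit Arguments.
Unset Strict Implicit.
Unset Printing Implicit Defensive.

Import GRing.Theory.
Local Open Scope ring_scope.
Local Open Scope complex_scope.

(** * Characteristic polynomials under similarity and intertwining *)

Lemma char_poly_trmx (R : comNzRingType) n (M : 'M[R]_n) :
  char_poly M^T = char_poly M.
Proof.
rewrite /char_poly -[RHS]det_tr; congr (\det _).
by apply/matrixP=> i j; rewrite !mxE eq_sym.
Qed.

Lemma char_poly_conj (R : comUnitRingType) n (U M : 'M[R]_n) :
  U \in unitmx -> char_poly (U *m M *m invmx U) = char_poly M.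
Proof.
move=> Uu; have polyU := map_mxM (@polyC R).
have UV1 : map_mx (@polyC R) U *m map_mx (@polyC R) (invmx U) = 1%:M.
  by rewrite -polyU mulmxV // map_mx1.
rewrite /char_poly /char_poly_mx !polyU.
set U' := map_mx _ U in UV1 *; set V' := map_mx _ (invmx U) in UV1 *.
set M' := map_mx _ M.
have -> : 'X%:M - U' *m M' *m V' = U' *m ('X%:M - M') *m V'.
  by rewrite mulmxBr mulmxBl scalar_mxC -['X%:M *m U' *m V']mulmxA UV1 mulmx1.
by rewrite !det_mulmx mulrAC -det_mulmx UV1 det1 mul1r.
Qed.

Lemma char_poly_lblock (R : comNzRingType) m n
    (P : 'M[R]_m) (Q : 'M[R]_(n, m)) (S : 'M[R]_n) :
  char_poly (block_mx P 0 Q S) = char_poly P * char_poly S.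
Proof.
rewrite /char_poly /char_poly_mx map_block_mx map_mx0 scalar_mx_block.
by rewrite opp_block_mx add_block_mx subr0 det_lblock.
Qed.

(** The row space of [F] is stable under [M], which acts on it as [N]. Completing the rows of [F] to
    a basis makes [M] block lower triangular, with [N] as a diagonal block up to similarity. *)
Lemma char_poly_dvd_intertwine (K : fieldType) r n
    (F : 'M[K]_(r, n)) (N : 'M_r) (M : 'M_n) :
  row_free F -> F *m M = N *m F -> (char_poly N %| char_poly M)%R.
Proof.
move=> freeF FM.
have le_rn : (r <= n)%N by rewrite -(eqnP freeF) rank_leq_col.
(* Replacing [n] by [r + k] lets matrices of size [n] be cut into blocks. *)
move: (subnKC le_rn); move: (n - r)%N => k def_n.
case: n / def_n F M freeF FM {le_rn} => F M freeF FM.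
set L := col_ebase F; set U := row_ebase F.
have Lu : L \in unitmx := col_ebase_unit F.
have Uu : U \in unitmx := row_ebase_unit F.
have LF : invmx L *m F *m invmx U = row_mx 1%:M 0.
  by rewrite -[X in invmx L *m X]mulmx_ebase -/L -/U (eqnP freeF) pid_mx_row
    !mulmxA mulVmx // mul1mx mulmxK.
set S := U *m M *m invmx U.
have FS : row_mx 1%:M 0 *m S = (invmx L *m N *m L) *m row_mx 1%:M 0.
  rewrite -LF /S !mulmxA mulmxKV // mulmxK // -(mulmxA _ F) FM.
  by rewrite mulmxA.
rewrite -(char_poly_conj M Uu) -/S -[S]submxK.
move: FS; rewrite -[S]submxK mul_row_block !mul1mx !mul0mx !addr0.
rewrite mul_mx_row mulmx1 mulmx0 => /eq_row_mx[-> ->].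
rewrite submxK char_poly_lblock -{2}[L]invmxK char_poly_conj ?unitmx_inv //.
by rewrite dvdp_mulr.
Qed.

(** * Single-output pole placement *)

Lemma horner_mx_wide (R : comNzRingType) n k (M : 'M[R]_n.+1) (p : {poly R}) :
  (size p <= k)%N -> horner_mx M p = \sum_(i < k) p`_i *: M ^+ i.
Proof.
move=> sz_p; have {1}-> : p = \sum_(i < k) p`_i *: 'X^i.
  rewrite -poly_def; apply/polyP=> i; rewrite coef_poly.
  by case: ltnP => // /(leq_trans sz_p)/(nth_default 0).
rewrite rmorph_sum; apply: eq_bigr => i _.
rewrite -mul_polyC rmorphM rmorphXn /= horner_mx_C horner_mx_X.
by rewrite -mulmxE mul_scalar_mx.
Qed.

(* [q] stays a cyclic vector after the feedback, and [p] annihilates it: the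
   two monic polynomials of degree [n.+1] killing [q] coincide. *)
Lemma ackermann (K : fieldType) n (M : 'M[K]_n.+1) (b : 'rV_n.+1)
    (q : 'cV_n.+1) (p : {poly K}) :
  p \is monic -> size p = n.+2 ->
  (forall k, (k <= n)%N -> b *m M ^+ k *m q = (k == n)%:R%:M) ->
  char_poly (M - horner_mx M p *m q *m b) = p.
Proof.
move=> monp sz_p bMq; set l := horner_mx M p *m q; set N := M - l *m b.
(* Since [b M^k q = 0] for [k < n], the correction [l b] first acts at power [n.+1], where it
   subtracts exactly [l = p(M) q]; hence [p(N) q = 0]. *)
have NqM k : (k <= n)%N -> N ^+ k *m q = M ^+ k *m q.
  elim: k => [//|k IHk] ltkn.
  rewrite !exprS -!mulmxE -mulmxA IHk ?(ltnW ltkn) // mulmxBl -(mulmxA l).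
  rewrite (mulmxA b) bMq ?(ltnW ltkn) // (ltn_eqF ltkn).
  by rewrite raddf0 mulmx0 subr0 mulmxA.
have NqS : N ^+ n.+1 *m q = M ^+ n.+1 *m q - l.
  rewrite !exprS -!mulmxE -!mulmxA NqM // mulmxBl -mulmxA.
  by rewrite (mulmxA b) bMq // eqxx mulmx1.
have pNq : horner_mx N p *m q = 0.
  have coefSn : p`_n.+1 = 1 by move/monicP: monp; rewrite lead_coefE sz_p.
  have evalp (P : 'M_n.+1) :
      horner_mx P p *m q =
      (\sum_(i < n.+1) p`_i *: (P ^+ i *m q)) + P ^+ n.+1 *m q.
    rewrite (@horner_mx_wide _ _ n.+2) ?sz_p // big_ord_recr /= coefSn scale1r.
    rewrite mulmxDl mulmx_suml; congr (_ + _).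
    by apply: eq_bigr => i _; rewrite scalemxAl.
  rewrite evalp NqS (eq_bigr (fun i : 'I__ => p`_i *: (M ^+ i *m q))) => [|i _].
    by rewrite addrA -evalp subrr.
  by congr (_ *: _); apply: NqM; rewrite -ltnS.
clearbody N.
have cycN (d : {poly K}) : (size d <= n.+1)%N -> horner_mx N d *m q = 0 -> d = 0.
  move=> sz_d dNq; apply/eqP; apply: contraTT isT => nz_d.
  pose e := (size d).-1.
  have sz_e : size d = e.+1 by rewrite prednK // size_poly_gt0.
  have le_en : (e <= n)%N by rewrite -ltnS -sz_e.
  (* The shift by [n - e] brings the leading term to exponent [n], the only exponent up to [n] at
     which [b M^j q] is nonzero. *)
  have : b *m M ^+ (n - e) *m (horner_mx N d *m q) = (lead_coef d)%:M.
    rewrite (@horner_mx_wide _ _ e.+1) ?sz_e // mulmx_suml mulmx_sumr.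
    rewrite (eq_bigr (fun i : 'I__ => d`_i *: (n - e + i == n)%N%:R%:M))
      => [|i _].
      rewrite big_ord_recr /= subnK // eqxx big1 ?add0r => [|i _].
        by rewrite scale_scalar_mx mulr1.
      rewrite ltn_eqF ?raddf0 ?scaler0 //.
      by rewrite -[X in (_ < X)%N](subnK le_en) ltn_add2l.
    have le_ie : (i <= e)%N by rewrite -ltnS.
    rewrite -scalemxAl -scalemxAr; congr (_ *: _).
    rewrite NqM ?(leq_trans le_ie) // mulmxA -(mulmxA b) mulmxE -exprD bMq //.
    by rewrite -[X in (_ <= X)%N](subnK le_en) leq_add2l.
  rewrite dNq mulmx0 => /matrixP/(_ 0 0); rewrite !mxE eqxx mulr1n => /esym/eqP.
  by rewrite lead_coef_eq0 (negPf nz_d).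
apply/eqP; rewrite -subr_eq0; apply/eqP/cycN; last first.
  by rewrite rmorphB /= Cayley_Hamilton sub0r mulNmx pNq oppr0.
apply/leq_sizeP=> i; rewrite leq_eqVlt coefB => /predU1P[<-|lt_ni].
  have /monicP := char_poly_monic N; rewrite lead_coefE size_char_poly /= => ->.
  by move/monicP: monp; rewrite lead_coefE sz_p /= => ->; rewrite subrr.
by rewrite !nth_default ?size_char_poly ?sz_p ?subrr.
Qed.

(** * Reduction of several outputs to one *)

(* Stated on row spaces, so that it dualises reachability without a
   Kalman matrix. *)
Definition observable (K : fieldType) n m (A : 'M[K]_n) (C : 'M_(m, n)) :=
  forall k (V : 'M_(k, n)), (V *m A <= V)%MS -> (C <= V)%MS -> row_full V.

(* Heymann's chain: if the span of [x_0, ..., x_k] could not be left through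
   [x_k A + u C], it would contain [C] and be [A]-stable. *)
Lemma heymann_chain (K : fieldType) n m (A : 'M[K]_n) (C : 'M_(m, n)) k :
  observable A C -> (k < n)%N ->
  exists (X : nat -> 'rV[K]_n) (U : nat -> 'rV[K]_m),
    [/\ exists v, X 0%N = v *m C,
        forall i, (i < k)%N -> X i.+1 = X i *m A + U i *m C
      & \rank (\matrix_(i < k.+1) X i) = k.+1].
Proof.
move=> obs; elim: k => [|k IHk] ltkn.
  (* [C] has a nonzero row: otherwise the zero subspace would contain [C] and observability would
     force [n = 0]. *)
  have /row_subPn[h] : ~~ (C <= (0 : 'M_n))%MS.
    apply/negP=> C0; have := obs _ (0 : 'M_n).
    rewrite mul0mx submx_refl C0 /row_full mxrank0 => /(_ isT isT)/eqP n0.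
    by rewrite -n0 in ltkn.
  rewrite submx0 => nz.
  exists (fun=> row h C), (fun=> 0); split=> //.
    by exists (delta_mx 0 h); rewrite rowE.
  have -> : \matrix_(i < 1) row h C = row h C.
    by apply/row_matrixP=> j; rewrite rowK [RHS]row_id.
  by apply/eqP; rewrite eqn_leq rank_leq_row lt0n mxrank_eq0.
have [X [U [X0 XS rkX]]] := IHk (ltnW ltkn).
set V := \matrix_(i < k.+1) X i in rkX.
have XV i : (i <= k)%N -> (X i <= V)%MS.
  rewrite -ltnS => lt_ik; rewrite (_ : X i = row (Ordinal lt_ik) V) ?row_sub //.
  by rewrite rowK.
(* If [X k *m A] already leaves [V], take [u = 0]; otherwise add a row of [C] lying outside [V]. *)
have [u nV] : exists u : 'rV_m, ~~ ((X k *m A + u *m C)%R <= V)%MS.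
  case: (boolP (X k *m A <= V)%MS) => [XkA|nXkA]; last first.
    by exists 0; rewrite mul0mx addr0.
  have /row_subPn[i CiV] : ~~ (C <= V)%MS.
    apply/negP=> CV; have : row_full V.
      apply: obs => //; apply/row_subP=> i; rewrite row_mul rowK.
      have := leq_ord i; rewrite leq_eqVlt => /predU1P[-> //|lt_ik].
      (* The recursion gives [X_i A = X_{i+1} - U_i C], a difference of two elements of [V]. *)
      rewrite -(addrK (U i *m C) (X i *m A)) -XS // addmx_sub ?XV //.
      by rewrite eqmx_opp (submx_trans (submxMl _ _)).
    by rewrite /row_full rkX (ltn_eqF ltkn).
  exists (delta_mx 0 i); rewrite -rowE; apply: contra CiV => sV.
  by rewrite -(addKr (X k *m A) (row i C)) addmx_sub // eqmx_opp.
set x := X k *m A + u *m C in nV.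
exists (fun i => if i == k.+1 then x else X i).
exists (fun i => if i == k then u else U i).
split=> //.
  move=> i; rewrite ltnS leq_eqVlt eqSS => /predU1P[->|lt_ik].
    by rewrite eqxx ltn_eqF.
  by rewrite (ltn_eqF lt_ik) ltn_eqF ?XS // ltnS ltnW.
set W := matrix_of_fun _ _.
have WE i (lt_i : (i < k.+2)%N) : ((if i == k.+1 then x else X i) <= W)%MS.
  rewrite (_ : (if _ then _ else _) = row (Ordinal lt_i) W) ?row_sub //.
  by rewrite rowK.
apply/eqP; rewrite eqn_leq rank_leq_row -[X in (X < _)%N]rkX.
apply: rank_ltmx; apply/andP; split.
  apply/row_subP=> i; rewrite rowK; have := WE i (leqW (ltn_ord i)).
  by rewrite ltn_eqF.
apply: contra nV => /(submx_trans _); apply.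
by have := WE _ (ltnSn k.+1); rewrite eqxx.
Qed.

(** A preliminary injection [H] turns a full Heymann chain into the orbit of [X 0] under
    [M = A + H C]. As [X 0 = v C], the single output [v C] suffices for Ackermann's formula. *)
Lemma observer_pole_placement (K : fieldType) n m (A : 'M[K]_n) (C : 'M_(m, n))
    (p : {poly K}) :
  observable A C -> p \is monic -> size p = n.+1 ->
  exists L : 'M_(n, m), char_poly (A - L *m C) = p.
Proof.
case: n A C => [|n] A C obs monp sz_p.
  exists 0; rewrite /char_poly det_mx00 [p]size1_polyC ?sz_p //.
  by move/monicP: monp; rewrite lead_coefE sz_p /= => ->.
have [X [U [[v X0] XS rkX]]] := heymann_chain obs (ltnSn n).
set T := \matrix_(i < n.+1) X i in rkX.
have Tu : T \in unitmx by rewrite -row_free_unit /row_free rkX.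
(* The chain is a basis, so [H] can be prescribed on it by [X i *m H = U i]. *)
pose H : 'M_(n.+1, m) := invmx T *m \matrix_i U i.
pose M := A + H *m C.
have XH i : (i < n.+1)%N -> X i *m H = U i.
  move=> lt_i; have <- : row (Ordinal lt_i) T = X i by rewrite rowK.
  by rewrite /H mulmxA -row_mul mulmxV // row1 -rowE rowK.
have XM k : (k <= n)%N -> X 0%N *m M ^+ k = X k.
  elim: k => [|k IHk] ltkn; first by rewrite mulmx1.
  rewrite exprSr -mulmxE mulmxA IHk 1?ltnW // mulmxDr mulmxA XH ?XS //.
  exact: ltnW.
(* The last column of the inverse of [T] is dual to the chain: [X k *m q] is 1 for [k = n] and 0 for
   [k < n]. *)
pose q := invmx T *m delta_mx ord_max (0 : 'I_1).
have Xq k : (k <= n)%N -> X 0%N *m M ^+ k *m q = (k == n)%:R%:M.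
  move=> le_kn; have lt_k : (k < n.+1)%N by [].
  have -> : X 0%N *m M ^+ k = row (Ordinal lt_k) T by rewrite rowK XM.
  rewrite -row_mul mulKVmx //; apply/matrixP=> i j.
  by rewrite !mxE !ord1 !eqxx andbT mulr1n.
(* Subtracting [H] here absorbs the preliminary injection: [A - L C = M - p(M) q (v C)]. *)
exists (horner_mx M p *m q *m v - H).
rewrite -[RHS](ackermann monp sz_p Xq); congr char_poly.
by rewrite X0 mulmxBl opprB addrA [in RHS]/M !mulmxA.
Qed.

(** * Hautus test and duality *)

(* Over the closed field, a proper [A^T]-stable subspace containing the rows of
   [B^T] is annihilated by a left eigenvector of [A]. *)
Lemma hautus (K : fieldType) (L : numClosedFieldType) (f : {rmorphism K -> L})
    n m (A : 'M[K]_n) (B : 'M_(n, m)) :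
  (forall s : L, row_free (row_mx (s%:M - map_mx f A) (map_mx f B))) ->
  observable A^T B^T.
Proof.
move=> rkAB k V VA BV; rewrite -(row_full_map f).
have /submxP[D defVA] := VA; have /submxP[E defB] := BV.
set V' := map_mx f V; set A' := map_mx f A in rkAB *.
set B' := map_mx f B in rkAB *.
have AVT : A' *m V'^T = V'^T *m (map_mx f D)^T.
  by rewrite -trmx_mul -map_mxM -defVA map_mxM trmx_mul -map_trmx trmxK.
have BT : B' = V'^T *m (map_mx f E)^T.
  by rewrite -trmx_mul -map_mxM -defB -map_trmx trmxK.
have -> : row_full V' = row_free V'^T by rewrite /row_full /row_free mxrank_tr.
rewrite -kermx_eq0; apply: contraTT isT => nzW.
(* [W] spans the left annihilator of the transpose of [V']; it is stable under [A'] and killed by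
   [B']. *)
set W := row_base (kermx V'^T).
have WV : W *m V'^T = 0 by apply/sub_kermxP; rewrite eq_row_base.
have /submxP[G defG] : (W *m A' <= W)%MS.
  rewrite {2}/W eq_row_base; apply/sub_kermxP.
  by rewrite -mulmxA AVT mulmxA WV mul0mx.
have [|a /eigenvalueP[y Gy nzy]] := eigenvalue_closed G.
  by rewrite lt0n mxrank_eq0.
(* [y W] satisfies the equation of a left eigenvector of [A'] for [a] and is killed by [B'], so the
   pencil at [s = a] forces it to vanish. *)
have yW0 : y *m W = 0.
  apply/eqP; rewrite -(mulmx_free_eq0 _ (rkAB a)) mul_mx_row.
  rewrite mulmxBr -[y *m W *m A']mulmxA defG mulmxA Gy -scalemxAl mul_mx_scalar.
  by rewrite subrr BT mulmxA -(mulmxA y) WV mulmx0 mul0mx row_mx0.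
by rewrite -(mulmx_free_eq0 _ (row_base_free (kermx V'^T))) yW0 eqxx in nzy.
Qed.

(** Dual of output injection: the Hautus condition is tested over the closed field [L], but the gain
    is found over [K]. *)
Lemma pole_placement (K : fieldType) (L : numClosedFieldType)
    (f : {rmorphism K -> L}) n m (A : 'M[K]_n) (B : 'M_(n, m)) (p : {poly K}) :
  (forall s : L, row_free (row_mx (s%:M - map_mx f A) (map_mx f B))) ->
  p \is monic -> size p = n.+1 ->
  exists Z : 'M_(m, n), char_poly (A - B *m Z) = p.
Proof.
move=> /hautus obs monp sz_p.
have [H <-] := observer_pole_placement obs monp sz_p.
by exists H^T; rewrite -[RHS]char_poly_trmx linearB /= trmx_mul !trmxK.
Qed.

(** Conjugation permutes the factors, so it fixes every coefficient of the product. *)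
Lemma self_conjugate_real_poly (R : realType) (s : seq R[i]) :
  self_conjugate s ->
  exists p : {poly R}, map_poly (real_complex R) p = \prod_(z <- s) ('X - z%:P).
Proof.
move=> conj_s; set P := \prod_(z <- s) _.
have conjP : map_poly (@conjc R) P = P.
  rewrite rmorph_prod /= -[RHS](perm_big _ conj_s) big_map.
  by apply: eq_bigr => z _; rewrite rmorphB /= map_polyX map_polyC.
exists (map_poly (@complex.Re R) P); apply/polyP=> i.
rewrite !coef_map_id0 ?rmorph0 //.
move/polyP/(_ i): conjP; rewrite coef_map_id0 ?rmorph0 //.
case: (P`_i) => a c [] /eqP; rewrite eq_sym -addr_eq0 -mulr2n.
by rewrite Num.Theory.mulrn_eq0 /= => /eqP->.
Qed.

Theorem theorem4 (R : realType) (n m r : nat)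
  (A : 'M[R]_n) (B : 'M[R]_(n, m)) (F : 'M[R]_(r, n)) (Fm : 'M[R]_(n, r))
  (Lambda : r.-tuple R[i])
  (F_full_row_rank : \rank F = r)
  (Fm_ginv : generalized_inverse F Fm)
  (Lambda_left : forall z : R[i], z \in Lambda -> complex.Re z < 0)
  (Lambda_conj : self_conjugate Lambda)
  (rank_FA_F : \rank (col_mx (F *m A) F) = \rank F)
  (rank_pencil : forall s : R[i],
     \rank (row_mx (s *: complexify F - complexify (F *m A))
                   (complexify (F *m B))) = \rank F) :
  exists Z : 'M[R]_(m, r),
    eigenvalue_list (F *m A *m Fm - F *m B *m Z) Lambda /\
    exists others : seq R[i],
      eigenvalue_list (A - B *m Z *m F) (Lambda ++ others).
Proof.
have freeF : row_free F by apply/eqP.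
have FFm : F *m Fm = 1%:M.
  by apply: (row_free_inj freeF); rewrite mul1mx.
have /submxP[D defFA] : (F *m A <= F)%MS.
  have sF : (F <= col_mx (F *m A) F)%MS by rewrite -addsmxE addsmxSr.
  have := mxrank_leqif_sup sF; rewrite rank_FA_F => /geq_leqif.
  by rewrite leqnn col_mx_sub => /esym/andP[].
have FAE : F *m A = F *m A *m Fm *m F by rewrite defFA -(mulmxA D) FFm mulmx1.
have [p defp] := self_conjugate_real_poly Lambda_conj.
have monp : p \is monic.
  by rewrite -(map_monic (real_complex R)) defp monic_prod_XsubC.
have sz_p : size p = r.+1.
  by rewrite -(size_map_poly (real_complex R)) defp size_prod_XsubC size_tuple.
have pencil_free (s : R[i]) :
    row_free (row_mx (s%:M - map_mx (real_complex R) (F *m A *m Fm))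
                     (map_mx (real_complex R) (F *m B))).
  rewrite /row_free eqn_leq rank_leq_row -[X in (X <= _)%N]F_full_row_rank.
  rewrite -(rank_pencil s) {1}FAE /complexify (map_mxM _ _ F).
  (* With [F A = N F], the given pencil is [(s I - N, F B)] times [diag(F, I)], so its rank [r]
     bounds that of the left factor from below. *)
  have -> : row_mx (s *: map_mx (real_complex R) F -
        map_mx (real_complex R) (F *m A *m Fm) *m map_mx (real_complex R) F)
      (map_mx (real_complex R) (F *m B)) =
    row_mx (s%:M - map_mx (real_complex R) (F *m A *m Fm))
      (map_mx (real_complex R) (F *m B)) *m
    block_mx (map_mx (real_complex R) F) 0 0 1%:M.
    by rewrite mul_row_block !mulmx0 mulmx1 addr0 add0r mulmxBl mul_scalar_mx.
  exact: mxrankM_maxl.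
have [Z charZ] := pole_placement pencil_free monp sz_p.
exists Z; split; first by rewrite /eigenvalue_list -map_char_poly /= charZ.
have : (p %| char_poly (A - B *m Z *m F))%R.
  rewrite -charZ; apply: (@char_poly_dvd_intertwine _ _ _ F) => //.
  by rewrite mulmxBr mulmxBl -FAE !mulmxA.
rewrite -(dvdp_map (real_complex R)) defp map_char_poly => /dvdpP[Q defQ].
have [t defQt] := closed_field_poly_normal Q.
exists t; rewrite /eigenvalue_list big_cat /= /complexify defQ mulrC; congr (_ * _).
(* The quotient of two monic polynomials is monic, so its roots [t] supply exactly the remaining
   eigenvalues. *)
rewrite defQt (_ : lead_coef Q = 1) ?scale1r //.
have := char_poly_monic (map_mx (real_complex R) (A - B *m Z *m F)).
by rewrite defQ monicMr ?monic_prod_XsubC // => /monicP.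
Qed.
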